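(* Let $K$ be a field, let $\mathcal{O}=\{t_1,\dots,t_\mu\}$ be an order ideal in $\mathbb{T}^n$, let $\partial\mathcal{O}=\{b_1,\dots,b_\nu\}$ be its border, and let $G=\{g_1,\dots,g_\nu\}$ be the generic $\mathcal{O}$-border prebasis, where $g_j=b_j-\sum_{i=1}^\mu c_{ij}t_i$ for $j=1,\dots,\nu$. Then, for all $i\in\{1,\dots,\mu\}$ and $j\in\{1,\dots,\nu\}$, the following conditions are equivalent. (a) There exists an index $\ell\in\{1,\dots,n\}$ such that the indeterminate $c_{ij}\in C$ is $x_\ell$-exposed. (b) There exist indices $\ell\in\{1,\dots,n\}$ and $j'\in\{1,\dots,\nu\}$ such that $b_j,b_{j'}$ is a next-door neighbor pair with $b_{j'}=x_\ell b_j$ or an across-the-street neighbor pair with $x_kb_{j'}=x_\ell b_j$ for some $k\in\{1,\dots,n\}$, and such that if we write $$x_\ell g_j=x_\ell b_j-c_{i_1j}g_{j_1}-\cdots-c_{i_rj}g_{j_r}+\sum_{\lambda=1}^\mu f_\lambda t_\lambda$$ where $i_1,\dots,i_r\in\{1,\dots,\mu\}$ are pairwise distinct, where $j_1,\dots,j_r\in\{1,\dots,\nu\}$, and where $f_\lambda\in K[C]$, then we have $i\in\{i_1,\dots,i_r\}$. (c) There exist indices $\ell\in\{1,\dots,n\}$ and $j'\in\{1,\dots,\nu\}$ such that $b_j,b_{j'}$ is a next-door neighbor pair with $b_{j'}=x_\ell b_j$ or an across-the-street neighbor pair with $x_kb_{j'}=x_\ell b_j$ and $k\in\{1,\dots,n\}$,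 and such that the lifting of the neighbor syzygy $e_{j'}-x_\ell e_j$ resp. $x_ke_{j'}-x_\ell e_j$ is of the form $$x_k^\epsilon e_{j'}-x_\ell e_j-\sum_{\kappa=1}^\nu\bar f_\kappa e_\kappa\in\mathrm{Syz}_{B_{\mathcal{O}}}(\bar g_1,\dots,\bar g_\nu)$$ where $\epsilon\in\{0,1\}$ and $\bar f_\kappa\in B_{\mathcal{O}}$ are the residue classes of (possibly zero) monomials or binomials $f_\kappa\in K[C]$ such that one of their supports contains $c_{ij}$.
   Context: $\mathbb{T}^n$ is the set of terms (power products) in $x_1,\dots,x_n$. An order ideal is a finite set $\mathcal{O}=\{t_1,\dots,t_\mu\}\subseteq\mathbb{T}^n$ ($\mu\ge1$) closed under taking divisors; its border is $\partial\mathcal{O}=(x_1\mathcal{O}\cup\dots\cup x_n\mathcal{O})\setminus\mathcal{O}=\{b_1,\dots,b_\nu\}$. $C=(c_{ij})$ is a tuple of $\mu\nu$ indeterminates, $K[C]=K[c_{11},\dots,c_{\mu\nu}]$; the $g_j$ lie in $K[C][x_1,\dots,x_n]$. The generic multiplication matrix $\mathcal{A}_r\in\mathrm{Mat}_\mu(K[C])$ has $(i,j)$ entry $\delta_{im}$ if $x_rt_j=t_m$ and $c_{im}$ if $x_rt_j=b_m$; $I(\mathbb{B}_{\mathcal{O}})$ is the ideal generated by the entries of all commutators $\mathcal{A}_k\mathcal{A}_\ell-\mathcal{A}_\ell\mathcal{A}_k$; $B_{\mathcal{O}}=K[C]/I(\mathbb{B}_{\mathcal{O}})$. Border terms $b_j,b_{j'}$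 form a next-door neighbor pair if $b_{j'}=x_\ell b_j$ for some $\ell$ and an across-the-street neighbor pair if $x_kb_{j'}=x_\ell b_j$ for some $k\ne\ell$. $c_{ij}$ is $x_\ell$-exposed if $x_\ell t_i\in\partial\mathcal{O}$ and there exists $j'$ such that $b_j,b_{j'}$ is a next-door neighbor pair with $b_{j'}=x_\ell b_j$ or an across-the-street neighbor pair with $x_kb_{j'}=x_\ell b_j$ for some $k\in\{1,\dots,n\}$. Let $\bar g_j$ be the image of $g_j$ in $B_{\mathcal{O}}[x_1,\dots,x_n]$, and let $\mathrm{Syz}_{B_{\mathcal{O}}}(\bar g_1,\dots,\bar g_\nu)$ be the syzygy module of $(\bar g_1,\dots,\bar g_\nu)$ over $B_{\mathcal{O}}[x_1,\dots,x_n]$, a submodule of the free module with canonical basis $e_1,\dots,e_\nu$. For a neighbor pair, put $\epsilon=0$ in the next-door case $b_{j'}=x_\ell b_j$ and $\epsilon=1$ in the across-the-street case $x_kb_{j'}=x_\ell b_j$. The polynomial $x_k^\epsilon g_{j'}-x_\ell g_j$ is a $K[C]$-linear combination of terms in $\mathcal{O}\cup\partial\mathcal{O}$; let $f_\kappa\in K[C]$ be its coefficient at $b_\kappa$. Then $x_k^\epsilon e_{j'}-x_\ell e_j-\sum_\kappa\bar f_\kappa e_\kappa$ is a syzygy of $(\bar g_1,\dots,\bar g_\nu)$; it is called the lifting of the neighbor syzygy $x_k^\epsilon e_{j'}-x_\ell e_j$, and the $f_\kappa$ in (c) are these coefficients. *)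

(* Defs.v *)
From HB Require Import structures.
From mathcomp Require Import all_boot all_order all_algebra ring_quotient.
From mathcomp.classical Require Import boolp.
From mathcomp.multinomials Require Import mpoly.

Set Implicit Arguments.
Unset Strict Implicit.
Unset Printing Implicit Defensive.

Import GRing.Theory.
Local Open Scope ring_scope.
Local Open Scope quotient_scope.

(* A finite set of terms is given by an injective enumeration, the term
   x_1^(m 0) ... x_n^(m (n-1)) being the exponent vector m : 'X_{1..n}, so that
   a product of terms is written additively. *)

Definition is_order_ideal (n mu : nat) (t : 'I_mu -> 'X_{1..n}) : Prop :=
  [/\ (0 < mu)%N, injective t &
      forall (i : 'I_mu) (m : 'X_{1..n}), (m <= t i)%MM ->
        exists i' : 'I_mu, t i' = m].

Definition is_border (n mu nu : nat)
    (t : 'I_mu -> 'X_{1..n}) (b : 'I_nu -> 'X_{1..n}) : Prop :=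
  injective b /\
  forall m : 'X_{1..n},
    (exists j : 'I_nu, b j = m) <->
    (exists (l : 'I_n) (i : 'I_mu), m = (U_(l) + t i)%MM) /\
    ~ (exists i : 'I_mu, t i = m).

Section Neighbors.
Variables (n mu nu : nat) (t : 'I_mu -> 'X_{1..n}) (b : 'I_nu -> 'X_{1..n}).

Definition next_door (l : 'I_n) (j j' : 'I_nu) : Prop :=
  b j' = (U_(l) + b j)%MM.

Definition across_street (k l : 'I_n) (j j' : 'I_nu) : Prop :=
  k <> l /\ (U_(k) + b j' = U_(l) + b j)%MM.

Definition neighbors (l : 'I_n) (j j' : 'I_nu) : Prop :=
  next_door l j j' \/ exists k : 'I_n, across_street k l j j'.

Definition exposed (l : 'I_n) (i : 'I_mu) (j : 'I_nu) : Prop :=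
  (exists m : 'I_nu, b m = (U_(l) + t i)%MM) /\
  exists j' : 'I_nu, neighbors l j j'.

End Neighbors.

Section IdealSpan.
Variables (R : comNzRingType) (I : finType) (a : I -> R).

Definition ideal_span : {pred R} :=
  [pred p : R | `[< exists h : I -> R, p = \sum_x h x * a x >]].

Lemma ideal_span_closed : 1 \notin ideal_span -> idealr_closed ideal_span.
Proof.
move=> n1; split=> //.
- by apply/asboolP; exists (fun=> 0); rewrite big1 // => x _; rewrite mul0r.
- move=> c u v /asboolP[h ->] /asboolP[k ->]; apply/asboolP.
  exists (fun x => c * h x + k x); rewrite big_distrr -big_split /=.
  by apply: eq_bigr => x _; rewrite mulrDl mulrA.
Qed.

End IdealSpan.

Section Generic.
Variables (K : fieldType) (n mu nu : nat).
Variables (t : 'I_mu -> 'X_{1..n}) (b : 'I_nu -> 'X_{1..n}).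

(* K[C]: the indeterminates are numbered by 'I_(mu * nu) through mxvec_index *)
Notation KC := {mpoly K[mu * nu]}.

Definition Cterm (i : 'I_mu) (j : 'I_nu) : 'X_{1..mu * nu} :=
  U_(mxvec_index i j)%MM.

Definition Cvar (i : 'I_mu) (j : 'I_nu) : KC := 'X_[Cterm i j].

Definition generic_g (j : 'I_nu) : {mpoly KC[n]} :=
  'X_[b j] - \sum_(i < mu) Cvar i j *: 'X_[t i].

Definition generic_mulmx (r : 'I_n) : 'M[KC]_mu :=
  \matrix_(i, j)
    if [pick m | t m == (U_(r) + t j)%MM] is Some m then (i == m)%:R
    else if [pick m | b m == (U_(r) + t j)%MM] is Some m then Cvar i m
    else 0.

Definition commutator_entry (x : 'I_n * 'I_n * ('I_mu * 'I_mu)) : KC :=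
  let: (k, l, (i, j)) := x in
  (generic_mulmx k *m generic_mulmx l - generic_mulmx l *m generic_mulmx k) i j.

(* The argument hO makes the ideal proper, as {ideal_quot _} requires: all
   commutator entries vanish at c = 0 because t enumerates an order ideal. *)
Definition border_ideal (hO : is_order_ideal t) : {pred KC} :=
  ideal_span commutator_entry.

Lemma generic_mulmx_at0 (r : 'I_n) (i j : 'I_mu) : is_order_ideal t ->
  (generic_mulmx r i j).@[fun=> 0] = (t i == (U_(r) + t j)%MM)%:R.
Proof.
case=> _ tI _; rewrite mxE; case: pickP => [m /eqP <-|nt].
  by rewrite mevalMn meval1 (inj_eq tI).
rewrite nt; case: pickP => [m _|_]; last by rewrite meval0.
by rewrite /Cvar mevalXU.
Qed.

Lemma generic_mulmxM_at0 (k l : 'I_n) (i j : 'I_mu) : is_order_ideal t ->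
  ((generic_mulmx k *m generic_mulmx l) i j).@[fun=> 0]
    = (t i == (U_(k) + (U_(l) + t j))%MM)%:R.
Proof.
move=> hO; rewrite mxE raddf_sum /=.
under eq_bigr => m _ do rewrite mevalM !generic_mulmx_at0 //.
case: (hO) => _ tI tD; case: eqP => [e|ne]; last first.
  rewrite big1 // => m _; case: eqP => [e1|]; last by rewrite mul0r.
  by case: eqP => [e2|]; rewrite ?mulr0 //; case: ne; rewrite e1 e2.
have [m em] : exists m, t m = (U_(l) + t j)%MM.
  by apply: (tD i); rewrite e lem_addl.
rewrite (bigD1 m) //= em e !eqxx mulr1 big1 ?addr0 // => m' nm.
by rewrite -em (inj_eq tI) (negbTE nm) mulr0.
Qed.

Lemma border_ideal_closed (hO : is_order_ideal t) :
  idealr_closed (border_ideal hO).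
Proof.
apply: ideal_span_closed; apply/negP => /asboolP[h e].
have := congr1 (meval (fun=> 0)) e; rewrite meval1 raddf_sum big1 /=.
  by move/eqP; rewrite oner_eq0.
move=> [[k l] [i j]] _; rewrite mevalM /= mxE [X in _ + X]mxE.
rewrite mevalB !generic_mulmxM_at0 // addmA [(U_(k) + _)%MM]addmC -addmA.
by rewrite subrr mulr0.
Qed.

HB.instance Definition _ (hO : is_order_ideal t) :=
  isIdealr.Build KC (border_ideal hO) (border_ideal_closed hO).

Definition border_ring (hO : is_order_ideal t) : comNzRingType :=
  {ideal_quot border_ideal hO}.

Definition residue (hO : is_order_ideal t) (f : KC) : border_ring hO :=
  \pi_{ideal_quot border_ideal hO} f.

(* The neighbor pair is across the street (b_j' x_k = b_j x_l) if eps is true;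
   it is next-door (b_j' = b_j x_l) if eps is false, and then k is a dummy. *)
Definition lifting_coef (eps : bool) (k l : 'I_n) (j j' kappa : 'I_nu) : KC :=
  ('X_k ^+ eps * generic_g j' - 'X_l * generic_g j)@_(b kappa).

Definition lifting (hO : is_order_ideal t) (eps : bool) (k l : 'I_n)
    (j j' : 'I_nu) : 'rV[{mpoly (border_ring hO)[n]}]_nu :=
  'X_k ^+ eps *: delta_mx 0 j' - 'X_l *: delta_mx 0 j
  - \sum_(kappa < nu)
      (residue hO (lifting_coef eps k l j j' kappa))%:MP *: delta_mx 0 kappa.

Definition gbar (hO : is_order_ideal t) (j : 'I_nu) :
    {mpoly (border_ring hO)[n]} :=
  map_mpoly (residue hO) (generic_g j).

End Generic.

Definition syz (R : comNzRingType) (nu : nat) (g : 'I_nu -> R) :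
    {pred 'rV[R]_nu} :=
  [pred u : 'rV[R]_nu | \sum_(kappa < nu) u 0 kappa * g kappa == 0].

Arguments Cvar K {mu nu} i j.

(* Main.v *)
Require Import Defs.
From HB Require Import structures.
From mathcomp Require Import all_boot all_order all_algebra ring_quotient.
From mathcomp.classical Require Import boolp.
From mathcomp.multinomials Require Import mpoly.

Set Implicit Arguments.
Unset Strict Implicit.
Unset Printing Implicit Defensive.

Import GRing.Theory.

Local Open Scope ring_scope.

(** All three conditions say that some product x_l t_i is a border term and that
    b_j has a neighbor b_j' in the direction x_l; what links them is the normal
    form of x_l g_j.  Write T(v) for the combination of the terms t_i with the
    coefficients v_i, so that g_j = b_j - T(c_j) where c_j is the j-th column of
    indeterminates.  Multiplying T(v) by x_l sends each t_i either to a term of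
    the order ideal or to a border term b_m = g_m + T(c_m), and this is what the
    columns of the generic multiplication matrix A_l record; hence
      x_l T(v) = T(A_l v) + sum of v_i g_m over the pairs with x_l t_i = b_m
    ([shift_comb]).  As T(v) has no border term and g_m has just b_m, the
    multipliers of the g_m can be read off as coefficients at border terms.

    Condition (b).  For v = c_j the formula gives one representation of x_l g_j
    of the required shape, in which precisely the c_ij with x_l t_i in the
    border occur.  Conversely, if x_l t_i = b_m, then the coefficient of
    x_l T(c_j) at b_m is c_ij, so in any representation c_ij is a sum of some
    of the c_(i_s)j, and comparing linear parts forces i to be one of the i_s.

    Condition (c).  For a neighbor pair the terms x_k^eps b_j' and x_l b_j
    cancel in x_k^eps g_j' - x_l g_j, leaving x_l T(c_j) - x_k^eps T(c_j').
    At a border term each of the two products contributes at most one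
    indeterminate, from column j and from column j' respectively.  Since j and
    j' differ nothing cancels, and c_ij occurs in one of the f_kappa exactly
    when x_l t_i is a border term ([mem_lifting_coefP]).

    That the lifting is a syzygy amounts to A_l c_j = A_k^eps c_j' over the
    border ring, where the multiplication matrices commute.  This is proved for
    arbitrary commuting matrices whose columns are those prescribed by the order
    ideal: a neighbor pair is traced back to terms of the order ideal, on which
    both sides become products of two matrices applied to a basis vector
    ([next_door_col], [across_street_col]). *)

(** * Terms, order ideals and borders *)

(** In x_k m = x_l m' with k and l distinct, m is divisible by x_l; the common
    cofactor w is the corner of the square that the two products close. *)
Lemma mnm1_pushout (n : nat) (k l : 'I_n) (m m' : 'X_{1..n}) :
  k <> l -> (U_(k) + m = U_(l) + m')%MM ->
  exists w, m = (U_(l) + w)%MM /\ m' = (U_(k) + w)%MM.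
Proof.
move=> nkl e; have le : (U_(l) <= m)%MM.
  have := congr1 (fun f : 'X_{1..n} => f l) e.
  rewrite !mnmDE !mnm1E eqxx lep1mP; case: eqP => [//|_] /=.
  by rewrite add0n add1n => ->.
exists (m - U_(l))%MM; split; first by rewrite addmC submK.
apply: (@addmI _ U_(l)%MM).
rewrite -e -{1}(submK le) addmA [(U_(k) + _)%MM]addmC addmC.
by rewrite addmA [(U_(l) + _)%MM]addmC -addmA.
Qed.

Lemma border_out n mu nu (t : 'I_mu -> 'X_{1..n}) (b : 'I_nu -> 'X_{1..n}) i j :
  is_border t b -> t i <> b j.
Proof.
case=> _ hb e; have [_ ne] := (hb (b j)).1 (ex_intro _ j erefl).
by apply: ne; exists i.
Qed.

Lemma shift_cases n mu nu (t : 'I_mu -> 'X_{1..n}) (b : 'I_nu -> 'X_{1..n})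
    (l : 'I_n) (i : 'I_mu) : is_border t b ->
  (exists m, t m = (U_(l) + t i)%MM) \/ (exists m, b m = (U_(l) + t i)%MM).
Proof.
case=> _ hb; case: (pickP (fun m => t m == (U_(l) + t i)%MM)) => [m /eqP e|no].
  by left; exists m.
right; apply/hb; split; first by exists l, i.
by case=> m /eqP; rewrite no.
Qed.

Lemma border_split n mu nu (t : 'I_mu -> 'X_{1..n}) (b : 'I_nu -> 'X_{1..n})
    (j : 'I_nu) : is_border t b -> exists s p, b j = (U_(s) + t p)%MM.
Proof. by case=> _ hb; case: ((hb (b j)).1 (ex_intro _ j erefl)). Qed.

Local Notation basis_col i := (delta_mx i (0 : 'I_1)).

(** * Columns of commuting multiplication matrices *)

Section CommutingMatrices.
Variables (R : comNzRingType) (n mu nu : nat).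
Variables (t : 'I_mu -> 'X_{1..n}) (b : 'I_nu -> 'X_{1..n}).
Hypotheses (hO : is_order_ideal t) (hb : is_border t b).
Variables (A : 'I_n -> 'M[R]_mu) (C : 'I_nu -> 'cV[R]_mu).
Hypothesis A_inner : forall l i m, t m = (U_(l) + t i)%MM ->
  A l *m basis_col i = basis_col m.
Hypothesis A_border : forall l i m, b m = (U_(l) + t i)%MM ->
  A l *m basis_col i = C m.
Hypothesis A_comm : forall k l, A k *m A l = A l *m A k.

(** Write b_j' = x_s t_p.  Then s <> l, for otherwise b_j = t_p would lie in the
    order ideal, so t_p = x_l t_q and b_j = x_s t_q for some t_q: the square with
    sides x_l and x_s starts inside the order ideal, and both paths around it
    are available as columns of A_l and A_s. *)
Lemma next_door_col l j j' : next_door b l j j' -> C j' = A l *m C j.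
Proof.
rewrite /next_door => e; have [s [p ep]] := border_split j' hb.
have nsl : s <> l.
  by move=> esl; apply: (border_out (i := p) (j := j) hb);
     apply: (@addmI _ U_(l)%MM); rewrite -e ep esl.
have [w [epw ejw]] : exists w, t p = (U_(l) + w)%MM /\ b j = (U_(s) + w)%MM.
  by apply: mnm1_pushout nsl _; rewrite -ep e.
have [q eq] : exists q, t q = w.
  by case: hO => _ _ /(_ p); apply; rewrite epw lem_addl.
subst w.
by rewrite -(A_border ejw) mulmxA A_comm -mulmxA (A_inner epw) (A_border ep).
Qed.

(** Here b_j = x_k w and b_j' = x_l w.  If w is in the order ideal, both columns
    come from the basis vector of w.  Otherwise w is itself a border term, with
    b_j and b_j' as its next-door neighbors, and their columns come from the
    column of w. *)
Lemma across_street_col k l j j' :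
  across_street b k l j j' -> A k *m C j' = A l *m C j.
Proof.
case=> nkl /(mnm1_pushout nkl) [w [ej' ej]].
case: (pickP (fun q => t q == w)) => [q /eqP eq|no].
  by subst w; rewrite -(A_border ej) -(A_border ej') !mulmxA A_comm.
have [s [p ep]] := border_split j hb.
(* From x_s t_p = x_k w one gets t_p = x_k u and w = x_s u; so u is in the order
   ideal and w, which is not, is a border term. *)
have nsk : s <> k.
  move=> esk; have /eqP[] := no p; apply: (@addmI _ U_(k)%MM).
  by rewrite -ej ep esk.
have [u [epu ewu]] : exists u, t p = (U_(k) + u)%MM /\ w = (U_(s) + u)%MM.
  by apply: mnm1_pushout nsk _; rewrite -ep ej.
have [q eq] : exists q, t q = u.
  by case: hO => _ _ /(_ p); apply; rewrite epu lem_addl.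
have [[m em]|[m em]] := shift_cases s q hb.
  by have := no m; rewrite em eq -ewu eqxx.
have emw : b m = w by rewrite em eq -ewu.
have -> : C j = A k *m C m by apply: next_door_col; rewrite /next_door emw.
have -> : C j' = A l *m C m by apply: next_door_col; rewrite /next_door emw.
by rewrite !mulmxA A_comm.
Qed.

End CommutingMatrices.

(** * Normal forms modulo the generic prebasis *)

Section Prebasis.
Variables (K : fieldType) (n mu nu : nat).
Variables (t : 'I_mu -> 'X_{1..n}) (b : 'I_nu -> 'X_{1..n}).
Hypotheses (hO : is_order_ideal t) (hb : is_border t b).
Notation KC := {mpoly K[mu * nu]}.
Notation g := (generic_g K t b).
Notation A := (generic_mulmx K t b).

Definition inner_comb (v : 'cV[KC]_mu) : {mpoly KC[n]} :=
  \sum_i v i 0 *: 'X_[t i].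

Definition Ccol (j : 'I_nu) : 'cV[KC]_mu := \col_i Cvar K i j.

Lemma inner_comb_is_additive : {morph inner_comb : u v / u - v}.
Proof.
move=> u v; rewrite /inner_comb -sumrB; apply: eq_bigr => i _.
by rewrite !mxE scalerBl.
Qed.

Lemma generic_gE j : g j = 'X_[b j] - inner_comb (Ccol j).
Proof.
by congr (_ - _); apply: eq_bigr => i _; rewrite mxE.
Qed.

Lemma mcoeff_inner_border v j : (inner_comb v)@_(b j) = 0.
Proof.
rewrite raddf_sum big1 //= => i _; rewrite mcoeffZ mcoeffX.
by case: eqP => [/(border_out hb)//|_]; rewrite mulr0.
Qed.

Lemma mcoeff_g_border j k : (g j)@_(b k) = (j == k)%:R.
Proof.
rewrite generic_gE mcoeffB mcoeff_inner_border subr0 mcoeffX.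
by case: hb => /inj_eq -> _.
Qed.

(** Border terms separate the prebasis from the span of the order ideal: this is
    what makes the multipliers of the g_m determined by the polynomial. *)
Lemma mcoeff_prebasis (I : finType) (P : pred I) (d : I -> KC)
    (js : I -> 'I_nu) v j :
  (inner_comb v + \sum_(x | P x) d x *: g (js x))@_(b j) =
  \sum_(x | P x && (js x == j)) d x.
Proof.
rewrite mcoeffD mcoeff_inner_border add0r raddf_sum big_mkcondr /=.
apply: eq_bigr => x _; rewrite mcoeffZ mcoeff_g_border.
by case: eqP; rewrite ?mulr1 ?mulr0.
Qed.

(** Collecting equal prebasis elements turns any reduction of p into the one
    whose multipliers are the coefficients of p at the border terms; this is the
    form in which the coefficients of a lifting are given. *)
Lemma prebasis_expansion (I : finType) (P : pred I) (d : I -> KC)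
    (js : I -> 'I_nu) v p :
  p = inner_comb v + \sum_(x | P x) d x *: g (js x) ->
  p = inner_comb v + \sum_kappa p@_(b kappa) *: g kappa.
Proof.
move=> ep; rewrite {1}ep; congr (_ + _).
rewrite (partition_big js predT) //=; apply: eq_bigr => kappa _.
rewrite ep mcoeff_prebasis scaler_suml.
by apply: eq_bigr => x /andP[_ /eqP ->].
Qed.

Lemma generic_mulmx_inner l i m : t m = (U_(l) + t i)%MM ->
  A l *m basis_col i = basis_col m.
Proof.
move=> e; rewrite -colE; apply/colP => p; rewrite !mxE eqxx andbT.
case: pickP => [m' /eqP|/(_ m)]; last by rewrite e eqxx.
by rewrite -e; case: hO => _ tI _ /tI ->.
Qed.

Lemma generic_mulmx_border l i m : b m = (U_(l) + t i)%MM ->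
  A l *m basis_col i = Ccol m.
Proof.
move=> e; rewrite -colE; apply/colP => p; rewrite !mxE.
case: pickP => [m' /eqP|_]; first by rewrite -e => /(border_out hb).
case: pickP => [m' /eqP|/(_ m)]; last by rewrite e eqxx.
by rewrite -e; case: hb => bI _ /bI ->.
Qed.

(** The border index is determined by the term index, but recording the pair
    gives the border term without choosing a default. *)
Definition border_shifts (l : 'I_n) : {set 'I_mu * 'I_nu} :=
  [set x | b x.2 == (U_(l) + t x.1)%MM].

Lemma shift_term l i :
  'X_l * 'X_[t i] =
  inner_comb (A l *m basis_col i)
  + \sum_(j | (i, j) \in border_shifts l) g j.
Proof.
rewrite -mpolyXD; case: (shift_cases l i hb) => [[m em]|[m em]].
  rewrite (generic_mulmx_inner em) big1 ?addr0.
    rewrite /inner_comb (bigD1 m) //= !mxE !eqxx scale1r em big1 ?addr0 //.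
    by move=> q /negPf nq; rewrite mxE nq scale0r.
  by move=> j; rewrite inE /= -em eq_sym => /eqP /(border_out hb).
rewrite (generic_mulmx_border em) (big_pred1 m).
  by rewrite generic_gE em addrC subrK.
by move=> j; rewrite inE /= -em; case: hb => /inj_eq -> _.
Qed.

(** Multiplication by x_l acts on the span of the order ideal as A_l, up to
    prebasis elements whose multipliers are entries of v itself. *)
Lemma shift_comb l v :
  'X_l * inner_comb v =
  inner_comb (A l *m v) + \sum_(x in border_shifts l) v x.1 0 *: g x.2.
Proof.
rewrite {1}/inner_comb mulr_sumr.
under eq_bigr do rewrite -scalerAr shift_term scalerDr.
rewrite big_split /=; congr (_ + _).
  under eq_bigr do rewrite scaler_sumr; rewrite exchange_big /=.
  apply: eq_bigr => m _; rewrite mxE scaler_suml; apply: eq_bigr => i _.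
  by rewrite scalerA -colE !mxE mulrC.
under eq_bigr do rewrite scaler_sumr.
by rewrite pair_big_dep /=; apply: eq_bigl => -[].
Qed.

Lemma mcoeff_shift_comb l v i j : b j = (U_(l) + t i)%MM ->
  ('X_l * inner_comb v)@_(b j) = v i 0.
Proof.
move=> e; rewrite mulr_sumr raddf_sum (bigD1 i) //= -scalerAr -mpolyXD.
rewrite mcoeffZ mcoeffX e eqxx mulr1 big1 ?addr0 // => p np.
rewrite -scalerAr -mpolyXD mcoeffZ mcoeffX; case: eqP => [|_].
  by move/addmI; case: hO => _ tI _ /tI ep; rewrite ep eqxx in np.
by rewrite mulr0.
Qed.

Lemma mcoeff_shift_comb0 l v j : (forall i, b j <> (U_(l) + t i)%MM) ->
  ('X_l * inner_comb v)@_(b j) = 0.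
Proof.
move=> ne; rewrite mulr_sumr raddf_sum big1 //= => i _.
rewrite -scalerAr -mpolyXD mcoeffZ mcoeffX.
by case: eqP => [/esym/ne//|_]; rewrite mulr0.
Qed.

(** A border term b_kappa has at most one quotient by x_k, so only one summand of
    the combination can reach it; for eps = 0 none does. *)
Lemma mcoeff_inner_shift (eps : bool) k j kappa :
  let f := ('X_k ^+ eps * inner_comb (Ccol j))@_(b kappa) in
  f = 0 \/ exists i, f = Cvar K i j /\ (eps -> b kappa = (U_(k) + t i)%MM).
Proof.
case: eps => /=; last by rewrite mul1r mcoeff_inner_border; left.
rewrite expr1.
case: (pickP (fun i => b kappa == (U_(k) + t i)%MM)) => [i /eqP e|no].
  by right; exists i; rewrite (mcoeff_shift_comb _ e) mxE.
by left; apply: mcoeff_shift_comb0 => i /eqP; rewrite no.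
Qed.

Lemma Cterm_inj (i i' : 'I_mu) (j j' : 'I_nu) :
  Cterm i j = Cterm i' j' -> i = i' /\ j = j'.
Proof.
move/eqP; rewrite eq_mnm1 => /eqP e.
have [f fK _] := curry_mxvec_bij mu nu.
have := fK (i, j); have /= := fK (i', j'); rewrite -e => -> // /(_ isT) [].
by move=> -> ->.
Qed.

Lemma msupp_Cvar (i : 'I_mu) (j : 'I_nu) : msupp (Cvar K i j) = [:: Cterm i j].
Proof. exact: msuppX. Qed.

(** * Neighbor pairs and their liftings *)

Definition neighbors_eps (eps : bool) (k l : 'I_n) (j j' : 'I_nu) :=
  if eps then across_street b k l j j' else next_door b l j j'.

Lemma neighbors_neq eps k l j j' : neighbors_eps eps k l j j' -> j <> j'.
Proof.
case: eps => /= [[nkl]|] + ejj; rewrite /next_door ejj => e.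
  by move/addIm/eqP: e; rewrite eq_mnm1 => /eqP.
have := congr1 (fun m : 'X_{1..n} => m l) e.
by rewrite mnmDE mnm1E eqxx => /eqP; rewrite -{1}[b j' l]add0n eqn_add2r.
Qed.

Lemma neighbor_difference eps k l j j' : neighbors_eps eps k l j j' ->
  'X_k ^+ eps * g j' - 'X_l * g j =
  'X_l * inner_comb (Ccol j) - 'X_k ^+ eps * inner_comb (Ccol j').
Proof.
move=> hn; rewrite !generic_gE !mulrBr.
have -> : 'X_k ^+ eps * 'X_[b j'] = 'X_l * 'X_[b j] :> {mpoly KC[n]}.
  case: eps hn => /= [[_]|]; first by rewrite expr1 -!mpolyXD => ->.
  by rewrite mul1r -mpolyXD => ->.
by rewrite opprB addrC addrA subrK.
Qed.

Section Lifting.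
Variables (eps : bool) (k l : 'I_n) (j j' : 'I_nu).
Hypothesis hn : neighbors_eps eps k l j j'.
Notation f := (lifting_coef K t b eps k l j j').

(** The exponent [true] gives both products the shape of [mcoeff_inner_shift]. *)
Lemma lifting_coefE kappa : f kappa =
  ('X_l ^+ true * inner_comb (Ccol j))@_(b kappa)
  - ('X_k ^+ eps * inner_comb (Ccol j'))@_(b kappa).
Proof. by rewrite /lifting_coef (neighbor_difference hn) mcoeffB expr1. Qed.

Lemma lifting_coef_binomial kappa : (size (msupp (f kappa)) <= 2)%N.
Proof.
rewrite lifting_coefE.
have le1 (e : bool) q p :
    (size (msupp ('X_q ^+ e * inner_comb (Ccol p))@_(b kappa)) <= 1)%N.
  have /= [->|[i [-> _]]] := mcoeff_inner_shift e q p kappa.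
    by rewrite msupp0.
  by rewrite msupp_Cvar.
rewrite (leq_trans (uniq_leq_size (msupp_uniq _) (@msuppB_le _ _ _ _))) //.
by rewrite size_cat (leq_add (n1 := 1) (n2 := 1)).
Qed.

(** The product with x_k^eps involves only the indeterminates of column j', and
    j' <> j: it neither contributes nor cancels c_ij. *)
Lemma mem_lifting_coefP i :
  (exists kappa, Cterm i j \in msupp (f kappa)) <->
  (exists m, b m = (U_(l) + t i)%MM).
Proof.
have nj' kappa :
  Cterm i j \notin msupp (('X_k ^+ eps * inner_comb (Ccol j'))@_(b kappa)).
  have /= [->|[i' [-> _]]] := mcoeff_inner_shift eps k j' kappa.
    by rewrite msupp0.
  rewrite msupp_Cvar inE; apply/eqP => /Cterm_inj[_].
  exact: neighbors_neq hn.
split=> [[kappa]|[m em]].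
  rewrite lifting_coefE => /msuppB_le; rewrite mem_cat => /orP[|hj']; last first.
    by case/negP: (nj' kappa).
  have /= [->|[i' [-> /(_ isT) e]]] := mcoeff_inner_shift true l j kappa.
    by rewrite msupp0.
  by rewrite msupp_Cvar inE => /eqP/Cterm_inj[-> _]; exists kappa.
exists m; rewrite mcoeff_msupp lifting_coefE mcoeffB (memN_msupp_eq0 (nj' _)).
by rewrite expr1 (mcoeff_shift_comb _ em) mxE mcoeffX eqxx subr0 oner_eq0.
Qed.

(** The coordinates, on the order ideal, of the part of x_k^eps g_j' - x_l g_j
    that is left after subtracting the prebasis elements. *)
Definition lifting_remainder : 'cV[KC]_mu :=
  A l *m Ccol j - (if eps then A k else 1%:M) *m Ccol j'.

Lemma neighbor_reduction :
  'X_k ^+ eps * g j' - 'X_l * g j =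
  inner_comb lifting_remainder + \sum_kappa f kappa *: g kappa.
Proof.
rewrite (neighbor_difference hn) /lifting_remainder inner_comb_is_additive.
under [in RHS]eq_bigr do rewrite lifting_coefE expr1 scalerBl.
rewrite sumrB addrACA -opprD; congr (_ - _).
  exact: prebasis_expansion (shift_comb _ _).
case: (eps); rewrite ?expr1 ?mul1r ?mul1mx.
  exact: prebasis_expansion (shift_comb _ _).
by rewrite big1 ?addr0 // => kappa _; rewrite mcoeff_inner_border scale0r.
Qed.

Lemma map_neighbor_reduction (S : comNzRingType) (phi : {rmorphism KC -> S}) :
  map_mx phi lifting_remainder = 0 ->
  'X_k ^+ eps * map_mpoly phi (g j') - 'X_l * map_mpoly phi (g j)
  - \sum_kappa (phi (f kappa))%:MP * map_mpoly phi (g kappa) = 0.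
Proof.
move=> rem0; have := congr1 (map_mpoly phi) neighbor_reduction.
rewrite rmorphB rmorphD !rmorphM rmorphXn /= !map_mpolyX => ->.
rewrite [map_mpoly phi (inner_comb _)]raddf_sum big1 => [|i _]; last first.
  have /colP/(_ i) := rem0; rewrite mxE [RHS]mxE => phi0.
  by rewrite /= map_mpolyZ phi0 scale0r.
rewrite add0r raddf_sum -sumrB big1 // => kappa _.
by rewrite /= map_mpolyZ mul_mpolyC subrr.
Qed.

End Lifting.

End Prebasis.

(** * Syzygies over the border ring *)

Section BorderScheme.
Variables (K : fieldType) (n mu nu : nat).
Variables (t : 'I_mu -> 'X_{1..n}) (b : 'I_nu -> 'X_{1..n}).
Hypotheses (hO : is_order_ideal t) (hb : is_border t b).
Notation KC := {mpoly K[mu * nu]}.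
Notation g := (generic_g K t b).
Notation A := (generic_mulmx K t b).

HB.instance Definition _ := GRing.RMorphism.copy (@residue K n mu nu t b hO)
  (\pi_{ideal_quot @border_ideal K n mu nu t b hO})%qT.

Lemma residue_commutator x : residue b hO (commutator_entry K t b x) = 0.
Proof.
rewrite -(raddf0 (residue b hO)); apply/eqP.
rewrite /residue -Quotient.idealrBE subr0; apply/asboolP.
exists (fun y => (y == x)%:R); rewrite (bigD1 x) //= eqxx mul1r big1 ?addr0 //.
by move=> y /negPf ->; rewrite mul0r.
Qed.

Lemma residue_mulmx_comm k l :
  map_mx (residue b hO) (A k) *m map_mx (residue b hO) (A l) =
  map_mx (residue b hO) (A l) *m map_mx (residue b hO) (A k).
Proof.
rewrite -!map_mxM; apply/eqP; rewrite -subr_eq0 -map_mxB.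
apply/eqP/matrixP => i j.
rewrite !mxE; have := residue_commutator (k, l, (i, j)).
by rewrite /commutator_entry !mxE.
Qed.

(** The remainder is the obstruction to the lifting being a syzygy; it dies in
    the border ring because the multiplication matrices commute there. *)
Lemma residue_remainder eps k l j j' : neighbors_eps b eps k l j j' ->
  map_mx (residue b hO) (lifting_remainder K t b eps k l j j') = 0.
Proof.
move=> hn; rewrite map_mxB; apply/eqP; rewrite subr_eq0 eq_sym; apply/eqP.
rewrite !map_mxM.
pose C j := map_mx (residue b hO) (Ccol K mu j).
have inner q i m : t m = (U_(q) + t i)%MM ->
    map_mx (residue b hO) (A q) *m basis_col i = basis_col m.
  move=> e; have := generic_mulmx_inner K b hO e.
  by move/(congr1 (map_mx (residue b hO))); rewrite map_mxM !map_delta_mx.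
have border q i m : b m = (U_(q) + t i)%MM ->
    map_mx (residue b hO) (A q) *m basis_col i = C m.
  move=> e; have := generic_mulmx_border K hb e.
  by move/(congr1 (map_mx (residue b hO))); rewrite map_mxM !map_delta_mx.
case: eps hn => /= hn.
  exact (across_street_col hO hb inner border residue_mulmx_comm hn).
rewrite map_mx1 mul1mx.
exact (next_door_col hO hb inner border residue_mulmx_comm hn).
Qed.

Lemma lifting_syzygy eps k l j j' : neighbors_eps b eps k l j j' ->
  lifting K b hO eps k l j j' \in syz (gbar K b hO).
Proof.
move=> hn; rewrite inE; apply/eqP.
pose G := \col_kappa gbar K b hO kappa.
transitivity ((lifting K b hO eps k l j j' *m G) 0 0).
  by rewrite mxE; apply: eq_bigr => kappa _; rewrite [G _ _]mxE.
have dot a q : ((a *: (delta_mx 0 q : 'rV_nu)) *m G) 0 0 = a * gbar K b hO q.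
  by rewrite -scalemxAl -rowE mxE [row q G 0 0]mxE [G q 0]mxE.
rewrite /lifting mulmxBl mulmx_suml [LHS]mxE mulmxBl [X in X + _ = _]mxE dot.
rewrite [X in _ + X + _ = _]mxE dot [X in _ + X = _]mxE summxE.
under eq_bigr do rewrite dot.
exact (map_neighbor_reduction hO hb hn (residue_remainder hn)).
Qed.

End BorderScheme.

Theorem proposition2p9 (K : fieldType) (n mu nu : nat)
    (t : 'I_mu -> 'X_{1..n}) (b : 'I_nu -> 'X_{1..n})
    (hO : is_order_ideal t) (hb : is_border t b)
    (i : 'I_mu) (j : 'I_nu) :
  let c : 'I_mu -> 'I_nu -> {mpoly K[mu * nu]} := Cvar K in
  let g : 'I_nu -> {mpoly {mpoly K[mu * nu]}[n]} := generic_g K t b in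
  [<->
    (* (a) *)
    exists l : 'I_n, exposed t b l i j;
    (* (b) *)
    exists (l : 'I_n) (j' : 'I_nu),
      neighbors b l j j' /\
      forall (r : nat) (is_ : 'I_r -> 'I_mu) (js : 'I_r -> 'I_nu)
             (f : 'I_mu -> {mpoly K[mu * nu]}),
        injective is_ ->
        'X_l * g j = 'X_l * 'X_[b j] - \sum_(s < r) c (is_ s) j *: g (js s)
                     + \sum_(lambda < mu) f lambda *: 'X_[t lambda] ->
        exists s : 'I_r, is_ s = i;
    (* (c) *)
    exists (l : 'I_n) (j' : 'I_nu) (k : 'I_n) (eps : bool),
      let f := lifting_coef K t b eps k l j j' in
      [/\ if eps then across_street b k l j j' else next_door b l j j',
          lifting K b hO eps k l j j' \in syz (gbar K b hO),
          forall kappa : 'I_nu, (size (msupp (f kappa)) <= 2)%N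
        & exists kappa : 'I_nu, Cterm i j \in msupp (f kappa)]
  ].
Proof.
move=> c g; tfae.
(* Compare coefficients at the border term b_m = x_l t_i: c_ij is a sum of some
   of the indeterminates of the representation. *)
- case=> l [[m em] [j' hn]]; exists l, j'; split=> // r is_ js f _ e.
  have {e} : 'X_l * inner_comb t (Ccol K mu j) =
      inner_comb t (\col_q - f q) + \sum_s c (is_ s) j *: g (js s).
    have -> : inner_comb t (\col_q - f q) = - \sum_q f q *: 'X_[t q].
      by rewrite -sumrN; apply: eq_bigr => q _; rewrite mxE scaleNr.
    move: e; rewrite /g generic_gE mulrBr -addrA => /addrI.
    by move/(congr1 -%R); rewrite opprK opprD opprK addrC => ->.
  move/(congr1 (mcoeff (b m))).
  rewrite (mcoeff_shift_comb hO _ em) mcoeff_prebasis // mxE.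
  case: (pickP (fun s => is_ s == i)) => [s /eqP|no]; first by exists s.
  move/(congr1 (mcoeff (Cterm i j))); rewrite mcoeffX eqxx raddf_sum big1.
    by move/eqP; rewrite oner_eq0.
  move=> s _; rewrite /= mcoeffX; case: eqP => [/Cterm_inj[ei _]|//].
  by have := no s; rewrite /= ei eqxx.
- case=> l [j' [hn rep]].
  (* The reduction of x_l T(c_j) is a representation in which only indices of
     terms shifted into the border occur. *)
  have hi : exists m, b m = (U_(l) + t i)%MM.
    pose S := border_shifts t b l.
    pose w := generic_mulmx K t b l *m Ccol K mu j.
    have [||s es] := rep #|S| (fun s => (enum_val s).1)
      (fun s => (enum_val s).2) (fun q => - w q 0).
    - move=> s s' /= es; apply: enum_val_inj.
      have := enum_valP s; have := enum_valP s'.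
      rewrite !inE es => /eqP e1 /eqP e2.
      case: hb => bI _; case: (enum_val s) (enum_val s') es e1 e2.
      by move=> ? ? [? ?] /= -> <- /bI ->.
    - rewrite /g generic_gE mulrBr (shift_comb hO hb) -addrA; congr (_ + _).
      rewrite opprD big_enum_val [in RHS]addrC; congr (_ - _).
        by rewrite -sumrN; apply: eq_bigr => q _; rewrite scaleNr.
      by apply: eq_bigr => s _; rewrite mxE.
    have := enum_valP s; rewrite inE es => /eqP e.
    by exists (enum_val s).2.
  have [k [eps hne]] : exists k eps, neighbors_eps b eps k l j j'.
    case: hn => [nd|[k ac]]; first by exists l, false.
    by exists k, true.
  exists l, j', k, eps; split=> //.
  + exact: lifting_syzygy.
  + exact: lifting_coef_binomial.
  + exact/(mem_lifting_coefP K hO hb hne).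
- case=> l [j' [k [eps /= [hne _ _ hi]]]]; exists l; split.
    exact/(mem_lifting_coefP K hO hb hne).
  exists j'; case: eps hne {hi} => /= hne; last by left.
  by right; exists k.
Qed.
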